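(* There are no weighted small-step walks $W$ in the quadrant for which the associated group $G_W$ has order $12$.
   Context: A weighted small-step walk $W$ in the quadrant is given by real weights $p_{ij}\ge 0$, $i,j\in\{-1,0,1\}$, with $\sum_{i,j=-1}^{1}p_{ij}=1$. Its inventory is $$\chi_W(x,y)=\sum_{i,j=-1}^1 p_{ij}x^iy^j = xA_1(y)+B_1(y)+\frac{C_1(y)}{x}=yA_2(x)+B_2(x)+\frac{C_2(x)}{y},$$ where $A_1,B_1,C_1$ are Laurent polynomials in $y$ and $A_2,B_2,C_2$ are Laurent polynomials in $x$. It is assumed that none of $A_1,C_1,A_2,C_2$ is identically zero, so that $$\varphi_1(x,y)=\left(\frac{C_1(y)}{xA_1(y)},\,y\right),\qquad \varphi_2(x,y)=\left(x,\,\frac{C_2(x)}{yA_2(x)}\right)$$ are birational involutions of the $(x,y)$-plane. The group of $W$ is $G_W=\langle\varphi_1,\varphi_2\rangle$, the group of birational transformations of the $(x,y)$-plane generated by them. *)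

(* Defs.v *)
From HB Require Import structures.
From mathcomp Require Import all_boot all_order all_algebra.
From mathcomp Require Import generic_quotient.
From mathcomp Require Import ring.
From mathcomp Require Import classical_sets cardinality reals.

Set Implicit Arguments.
Unset Strict Implicit.
Unset Printing Implicit Defensive.

Import Order.TTheory GRing.Theory Num.Theory.
Local Open Scope ring_scope.
Local Open Scope quotient_scope.
Local Open Scope classical_set_scope.

Section RationalMaps.
Variable K : fieldType.

(* K(x, y).  As in polyXY, the outer variable of {poly {poly K}} is x and the
   inner one is y. *)
Definition ratfun := {fraction {poly {poly K}}}.

Definition cst (c : K) : ratfun := tofrac c%:P%:P.
Definition varx : ratfun := tofrac 'X.
Definition vary : ratfun := tofrac 'Y.

(* (u, v) stands for the rational self-map of the plane
   (x, y) |-> (u(x, y), v(x, y)). *)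
Definition ratmap := (ratfun * ratfun)%type.

Definition evalXY (P : {poly {poly K}}) (f : ratmap) : ratfun :=
  (map_poly (map_poly cst) P).[f.1, f.2].

(* The rational function h(u, v) for f = (u, v).  When f is dominant (u and v
   algebraically independent over K), in particular when f is birational, the
   denominator does not vanish and the value does not depend on the chosen
   fraction representing h. *)
Definition ratsubst (h : ratfun) (f : ratmap) : ratfun :=
  evalXY \n_(repr h) f / evalXY \d_(repr h) f.

Definition id_ratmap : ratmap := (varx, vary).

(* g after f *)
Definition compmap (g f : ratmap) : ratmap := (ratsubst g.1 f, ratsubst g.2 f).

Definition inverse_maps (f g : ratmap) : Prop :=
  compmap f g = id_ratmap /\ compmap g f = id_ratmap.

Definition group_closed (M : set ratmap) : Prop :=
  [/\ M id_ratmap,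
      forall f g, M f -> M g -> M (compmap f g)
    & forall f g, M f -> inverse_maps f g -> M g].

(* When S consists of birational maps, so does this set, and it is the subgroup
   generated by S in the group of birational transformations of the plane. *)
Definition generated_group (S : set ratmap) : set ratmap :=
  smallest group_closed S.

End RationalMaps.

Arguments varx {K}.
Arguments vary {K}.

Definition steps : seq int := [:: -1; 0; 1].

Section Walk.
Variables (K : fieldType) (p : int -> int -> K).

(* Only the values p i j with i and j in steps are ever used. *)
Definition inventory : ratfun K :=
  \sum_(i <- steps) \sum_(j <- steps) cst (p i j) * varx ^ i * vary ^ j.

Definition coefx (i : int) : ratfun K :=
  \sum_(j <- steps) cst (p i j) * vary ^ j.
Definition coefy (j : int) : ratfun K :=
  \sum_(i <- steps) cst (p i j) * varx ^ i.

Definition A1 := coefx 1.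
Definition B1 := coefx 0.
Definition C1 := coefx (-1).
Definition A2 := coefy 1.
Definition B2 := coefy 0.
Definition C2 := coefy (-1).

Lemma inventory_x : inventory = varx * A1 + B1 + C1 / varx.
Proof.
rewrite /inventory /A1 /B1 /C1 /coefx /steps !big_cons !big_nil.
rewrite !expr0z !expr1z !exprN1; ring.
Qed.

Lemma inventory_y : inventory = vary * A2 + B2 + C2 / vary.
Proof.
rewrite /inventory /A2 /B2 /C2 /coefy /steps !big_cons !big_nil.
rewrite !expr0z !expr1z !exprN1; ring.
Qed.

Definition phi1 : ratmap K := (C1 / (varx * A1), vary).
Definition phi2 : ratmap K := (varx, C2 / (vary * A2)).

Definition walk_group : set (ratmap K) :=
  generated_group [set phi1; phi2].

End Walk.

(* Main.v *)
Require Import Defs.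
From HB Require Import structures.
From mathcomp Require Import all_boot all_order all_algebra.
From mathcomp Require Import generic_quotient finmap.
From mathcomp Require Import ring lra zify.
From mathcomp Require Import boolp classical_sets cardinality reals.

Set Implicit Arguments.
Unset Strict Implicit.
Unset Printing Implicit Defensive.

Import Order.TTheory GRing.Theory Num.Theory.
Local Open Scope ring_scope.
Local Open Scope classical_set_scope.
Local Open Scope card_scope.

(** Because the weights are nonnegative, phi1 and phi2 map the open positive
quadrant Q of the real plane to itself, and there they are honest involutions.
A rational function is determined by its values on Q, so the group can be
studied through the alternating words 1, phi2, phi1 phi2, phi2 phi1 phi2, ...
acting on Q ([alternate n], represented by [alternate_map n]).

Let q = (x, y) go to infinity with y large and x larger than every power of y.
In this corner a Laurent polynomial with nonnegative coefficients has the
order of magnitude of its extreme monomial, so each coordinate of each word has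
the order of magnitude of a Laurent monomial of x and y ([alternate_order]).
The exponents are transformed by piecewise linear (tropical) reflections, whose
slopes, one for a large argument and one for a small argument, are differences
of two exponents among -1, 0, 1 and so lie between -2 and 2.  A finite
computation over all the slopes ([tropical_dichotomy]) leaves two cases.

- The words of length 0, ..., 12 have 13 different exponents.  Then they are
  13 different elements of the group.

- The exponents of some word S of length n = 4, 6, 8 or 10 are those of the
  identity.  Then S maps the corner to itself.  Rational functions have a
  constant sign in the corner, hence are totally ordered there, and S acts on
  them preserving this order.  If the group is finite, then S has finite order,
  and an order automorphism of finite order of a totally ordered set is the
  identity: x < S x would give x < S x < S (S x) < ... < x.  So S = 1
  ([finite_order_id]) and the group has at most n elements, n <= 10
  ([group_alternate_map]).

In neither case is the order 12.  The point of the computation is that the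
tropical rotation phi1 phi2 may have order 2, 3, 4, 5 or at least 7 (or be of
infinite order), but never order 6. *)

(** * Values of rational functions at points *)

Section Values.
Variable K : fieldType.

HB.instance Definition _ := GRing.RMorphism.copy (@cst K)
  (@tofrac _ \o polyC \o polyC : K -> ratfun K).

Implicit Types (q : K * K) (h : ratfun K) (P D : {poly {poly K}}) (f g : ratmap K).

(** The chosen fraction may depend on the point: [h] has the value [r] at [q]
when some fraction representing [h] has a nonzero denominator at [q]. With this
definition the functions regular at [q] are closed under all the operations,
and values are computed term by term. *)
Definition value_at h q (r : K) : Prop :=
  exists P D, [/\ h = tofrac P / tofrac D, D.[q.1, q.2] != 0
                & r = P.[q.1, q.2] / D.[q.1, q.2]].

Lemma ratfun_numden h :
  \d_(repr h) != 0 /\ h = tofrac \n_(repr h) / tofrac \d_(repr h).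
Proof.
split; first exact: denom_ratioP.
have d0 := denom_ratioP (repr h).
apply: (@mulIf _ (tofrac \d_(repr h))); rewrite ?divfK ?tofrac_eq0 //.
rewrite -{1}[h]reprK -{1}[repr h]Ratio_numden.
unlock FracField.tofrac; rewrite -[LHS]FracField.pi_mul.
apply/eqmodP => /=; rewrite FracField.equivfE.
by rewrite /FracField.mulf !numden_Ratio ?oner_neq0 ?mulr1 ?mul1r // mulrC.
Qed.

Lemma horner2M P D q : (P * D).[q.1, q.2] = P.[q.1, q.2] * D.[q.1, q.2].
Proof. by rewrite !hornerM. Qed.

Lemma horner2D P D q : (P + D).[q.1, q.2] = P.[q.1, q.2] + D.[q.1, q.2].
Proof. by rewrite !hornerD. Qed.

Lemma horner2_neq0 P q : P.[q.1, q.2] != 0 -> P != 0.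
Proof. by apply: contraNN => /eqP ->; rewrite !horner0. Qed.

Lemma value_at_tofrac P q : value_at (tofrac P) q P.[q.1, q.2].
Proof.
exists P, 1; split; first by rewrite tofrac1 divr1.
  by rewrite !hornerC oner_neq0.
by rewrite !hornerC divr1.
Qed.

Lemma value_at_cst c q : value_at (cst c) q c.
Proof. by have := value_at_tofrac c%:P%:P q; rewrite !hornerC. Qed.

Lemma value_at_varx q : value_at varx q q.1.
Proof. by have := value_at_tofrac 'X q; rewrite hornerX hornerC. Qed.

Lemma value_at_vary q : value_at vary q q.2.
Proof. by have := value_at_tofrac 'Y q; rewrite hornerC hornerX. Qed.

Lemma value_atD h1 h2 q r1 r2 :
  value_at h1 q r1 -> value_at h2 q r2 -> value_at (h1 + h2) q (r1 + r2).
Proof.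
move=> [P1 [D1 [-> d1 ->]]] [P2 [D2 [-> d2 ->]]].
exists (P1 * D2 + P2 * D1), (D1 * D2); rewrite horner2D !horner2M; split.
- by rewrite tofracD !tofracM addf_div // tofrac_eq0 (@horner2_neq0 _ q).
- by rewrite mulf_neq0.
- by rewrite addf_div.
Qed.

Lemma value_atM h1 h2 q r1 r2 :
  value_at h1 q r1 -> value_at h2 q r2 -> value_at (h1 * h2) q (r1 * r2).
Proof.
move=> [P1 [D1 [-> d1 ->]]] [P2 [D2 [-> d2 ->]]].
exists (P1 * P2), (D1 * D2); rewrite !horner2M !tofracM !mulf_div; split=> //.
by rewrite mulf_neq0.
Qed.

Lemma value_atV h q r : value_at h q r -> r != 0 -> value_at h^-1 q r^-1.
Proof.
move=> [P [D [-> d ->]]] r0; exists D, P; rewrite !invf_div; split=> //.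
by apply: contraNneq r0 => ->; rewrite mul0r.
Qed.

(** Cross-multiplied form, meaningful also where the fixed denominator [D]
vanishes; it lets a single fraction serve for all points. *)
Lemma value_at_cross h P D q r : h = tofrac P / tofrac D -> D != 0 ->
  value_at h q r -> P.[q.1, q.2] = r * D.[q.1, q.2].
Proof.
move=> -> D0 [P' [D' [/eqP e d' ->]]].
move: e; rewrite eqr_div ?tofrac_eq0 ?(horner2_neq0 d') // -!tofracM tofrac_eq.
move=> /eqP/(congr1 (fun p => p.[q.1, q.2])); rewrite !horner2M => e.
by apply: (mulIf d'); rewrite e mulrAC divfK // mulrC.
Qed.

Lemma value_at_uniq h q r1 r2 : value_at h q r1 -> value_at h q r2 -> r1 = r2.
Proof.
move=> [P [D [e d ->]]] /(value_at_cross e (horner2_neq0 d)) ->.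
by rewrite mulfK.
Qed.

Lemma value_at_evalXY P f q r1 r2 :
  value_at f.1 q r1 -> value_at f.2 q r2 ->
  value_at (evalXY P f) q P.[r1, r2].
Proof.
move=> v1 v2; rewrite /evalXY.
have inner (c : {poly K}) : value_at (map_poly (@cst K) c).[f.2] q c.[r2].
  elim/poly_ind: c => [|c a IH].
    by rewrite rmorph0 !horner0; have := value_at_cst 0 q; rewrite /cst !rmorph0.
  rewrite rmorphD rmorphM /= map_polyX map_polyC !hornerMXaddC.
  by apply: value_atD (value_at_cst a q); apply: value_atM.
elim/poly_ind: P => [|P c IH].
  by rewrite rmorph0 !horner0; have := value_at_cst 0 q; rewrite /cst !rmorph0.
rewrite rmorphD rmorphM /= map_polyX map_polyC !hornerMXaddC /= !hornerE.
by apply: value_atD (inner c); apply: value_atM.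
Qed.

End Values.

(** * Signs of rational functions near a corner at infinity *)

Section Germs.
Variable R : realType.
Implicit Types (q : R * R) (P : {poly {poly R}}) (c : {poly R}).

Definition positive q := (0 < q.1) && (0 < q.2).

(** The filter of neighbourhoods of the corner where y is large and x is large
compared with every power of y. Requiring only polynomial lower bounds on x makes
the filter stable under maps that preserve orders of magnitude. *)
Definition near_corner (A : R * R -> Prop) : Prop :=
  exists n : nat, forall q, n.+1%:R <= q.2 -> q.2 ^+ n.+1 <= q.1 -> A q.

Lemma near_cornerS A B :
  (forall q, positive q -> A q -> B q) -> near_corner A -> near_corner B.
Proof.
move=> AB [n nA]; exists n => q q2 q1; apply: AB; last exact: nA.
have q2_gt0 : 0 < q.2 by apply: lt_le_trans q2; rewrite ltr0Sn.
by rewrite /positive q2_gt0 andbT (lt_le_trans _ q1) // exprn_gt0.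
Qed.

Lemma near_cornerI A B :
  near_corner A -> near_corner B -> near_corner (fun q => A q /\ B q).
Proof.
move=> [m mA] [n nB]; exists (maxn m n) => q q2 q1.
have q2_ge1 : 1 <= q.2 by apply: le_trans q2; rewrite ler1n.
by split; [apply: mA | apply: nB];
  rewrite ?(le_trans _ q2) ?(le_trans _ q1) ?ler_nat ?ler_weXn2l //;
  rewrite ltnS ?leq_maxl ?leq_maxr.
Qed.

Lemma near_corner_ex A : near_corner A -> exists2 q, positive q & A q.
Proof.
move=> /(near_cornerS (B := fun q => positive q /\ A q)) [//|n nA].
have /(_ (lexx _) (lexx _))[pos Aq] := nA (n.+1%:R ^+ n.+1, n.+1%:R).
by exists (n.+1%:R ^+ n.+1, n.+1%:R).
Qed.

Lemma near_corner_y_ge M : near_corner (fun q => M <= q.2).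
Proof.
exists (Num.bound M) => q q2 _; apply: le_trans q2.
have [M0|M0] := leP 0 M; last by rewrite (le_trans (ltW M0)) ?ler0n.
by rewrite (le_trans (ltW (archi_boundP M0))) // ler_nat.
Qed.

Lemma near_corner_x_ge n : near_corner (fun q => q.2 ^+ n <= q.1).
Proof.
exists n => q q2; apply: le_trans; apply: ler_weXn2l => //.
by apply: le_trans q2; rewrite ler1n.
Qed.

Lemma poly_bound c : exists C n, 0 <= C /\ forall t, 1 <= t -> `|c.[t]| <= C * t ^+ n.
Proof.
elim/poly_ind: c => [|c a [C [n [C0 IH]]]].
  by exists 0, 0%N; split=> // t _; rewrite horner0 normr0 mul0r.
exists (C + `|a|), n.+1; split=> [|t t1]; first by rewrite addr_ge0.
rewrite hornerMXaddC mulrDl (le_trans (ler_normD _ _)) // lerD //.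
  rewrite normrM exprSr mulrA (ger0_norm (le_trans ler01 t1)).
  by rewrite ler_wpM2r ?IH // (le_trans ler01 t1).
by rewrite ler_peMr // exprn_ege1.
Qed.

(** A lower bound, and not just a sign, is what the induction on the degree
needs: multiplied by t it dominates the next constant coefficient. The real [s]
stands for the sign. *)
Lemma poly_sign_pinfty c : c != 0 ->
  exists s d M, 0 < d /\ forall t, M <= t -> d <= s * c.[t].
Proof.
elim/poly_ind: c => [|c a IH]; first by rewrite eqxx.
have [->|c0 _] := eqVneq c 0.
  rewrite mul0r add0r polyC_eq0 => a0; exists a, (a ^+ 2), 0.
  by split=> [|t _]; rewrite ?hornerC // exprn_even_gt0.
have [s [d [M [d0 cM]]]] := IH c0.
exists s, d, (Num.max M (1 + `|s * a| / d)); split=> // t.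
rewrite ge_max => /andP[Mt dt]; rewrite hornerMXaddC mulrDr mulrA.
have := ler_norm (- (s * a)); rewrite normrN => sa.
have dt' : d + `|s * a| <= d * t.
  by have := ler_wpM2l (ltW d0) dt; rewrite mulrDr mulr1 mulrCA divff ?gt_eqF ?mulr1.
have t0 : 0 <= t by apply: le_trans dt; rewrite addr_ge0 ?divr_ge0 // ltW.
have := ler_wpM2r t0 (cM t Mt); lra.
Qed.

(** Horner induction in x: if P is bounded away from 0 in the corner, then
P x dominates c(y), because c has polynomial growth and x exceeds all powers
of y. *)
Lemma poly2_sign P : P != 0 ->
  exists s d, 0 < d /\ near_corner (fun q => d <= s * P.[q.1, q.2]).
Proof.
elim/poly_ind: P => [|P c IH]; first by rewrite eqxx.
have [->|P0 _] := eqVneq P 0.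
  rewrite mul0r add0r polyC_eq0 => c0.
  have [s [d [M [d0 cM]]]] := poly_sign_pinfty c0.
  exists s, d; split=> //; apply: near_cornerS (near_corner_y_ge M) => q _ /cM.
  by rewrite hornerC.
have [s [d [d0 PN]]] := IH P0.
have [C [n [C0 cn]]] := poly_bound (s *: c).
exists s, d; split=> //.
have N := near_cornerI PN (near_cornerI (near_corner_x_ge n.+1)
  (near_corner_y_ge (1 + C / d))).
apply: near_cornerS N => q /andP[q1_gt0 q2_gt0] [Pd [q12 q2]].
have q2_ge1 : 1 <= q.2 by apply: le_trans q2; rewrite lerDl divr_ge0 // ltW.
have := cn _ q2_ge1; rewrite hornerZ => sc.
rewrite hornerMXaddC !hornerE mulrDr mulrA.
have := ler_norm (- (s * c.[q.2])); rewrite normrN => sc'.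
have := ler_wpM2r (ltW q1_gt0) Pd.
have dq1 : (d + C) * q.2 ^+ n <= d * q.1.
  apply: le_trans (ler_wpM2l (ltW d0) q12); rewrite exprSr mulrCA mulrC.
  rewrite ler_wpM2l ?exprn_ge0 ?(ltW q2_gt0) //.
  by have := ler_wpM2l (ltW d0) q2; rewrite mulrDr mulr1 mulrCA divff ?gt_eqF ?mulr1.
have : d * 1 <= d * q.2 ^+ n by rewrite ler_wpM2l ?(ltW d0) // exprn_ege1.
lra.
Qed.

Lemma poly2_eq0 P : near_corner (fun q => P.[q.1, q.2] = 0) -> P = 0.
Proof.
move=> P0; apply/eqP; apply: contraT => /poly2_sign[s [d [d0 N]]].
have [q _ [->]] := near_corner_ex (near_cornerI P0 N).
by rewrite mulr0 leNgt d0.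
Qed.

(** The relation between numerator and denominator of [h1] replaces the
regularity of [h1]: it is all that is known about an inverse map before it is
identified. *)
Lemma ratfun_eq_numden (h1 h2 : ratfun R) (v : R * R -> R) :
  near_corner (fun q => (\n_(repr h1)).[q.1, q.2] = v q * (\d_(repr h1)).[q.1, q.2]
    /\ value_at h2 q (v q)) -> h1 = h2.
Proof.
have [[d1 e1] [d2 e2]] := (ratfun_numden h1, ratfun_numden h2) => N.
rewrite e1 e2; apply/eqP; rewrite eqr_div ?tofrac_eq0 // -!tofracM tofrac_eq.
rewrite -subr_eq0; apply/eqP/poly2_eq0; apply: near_cornerS N => q _ [c1].
move=> /(value_at_cross e2 d2) c2.
by rewrite hornerD hornerN hornerD hornerN !horner2M c1 c2; ring.
Qed.

Lemma value_at_inj (h1 h2 : ratfun R) (v : R * R -> R) :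
  near_corner (fun q => value_at h1 q (v q) /\ value_at h2 q (v q)) -> h1 = h2.
Proof.
have [d e] := ratfun_numden h1 => N; apply: (@ratfun_eq_numden _ _ v).
by apply: near_cornerS N => q _ [/(value_at_cross e d)].
Qed.

(** Germs at the corner of rational functions regular on the positive quadrant
are totally ordered. *)
Lemma value_at_sign (h : ratfun R) (v : R * R -> R) :
  (forall q, positive q -> value_at h q (v q)) ->
  h = 0 \/ near_corner (fun q => 0 < v q) \/ near_corner (fun q => v q < 0).
Proof.
move=> hv; have [d e] := ratfun_numden h.
have [n0|n0] := eqVneq (\n_(repr h)) 0.
  by left; rewrite e n0 tofrac0 mul0r.
right; have [s [a [a0 sN]]] := poly2_sign n0.
have [t [b [b0 tN]]] := poly2_sign d.
have N := near_cornerI sN tN.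
have key q : positive q -> a <= s * (\n_(repr h)).[q.1, q.2] ->
    b <= t * (\d_(repr h)).[q.1, q.2] -> 0 < (s * t) * v q.
  move=> qpos; rewrite (value_at_cross e d (hv q qpos)).
  set D := (_).[_] => /(lt_le_trans a0) sp /(lt_le_trans b0) tp.
  have : 0 < (s * (v q * D)) * (t * D) by rewrite mulr_gt0.
  have -> : (s * (v q * D)) * (t * D) = (s * t * v q) * D ^+ 2 by ring.
  rewrite pmulr_lgt0 // exprn_even_gt0 //=.
  by apply: contraTneq tp => ->; rewrite mulr0 ltxx.
have [st|st|st] := ltrgtP (s * t) 0.
- right; apply: near_cornerS N => q qpos [/key k /k] /(_ qpos).
  by rewrite nmulr_rgt0.
- left; apply: near_cornerS N => q qpos [/key k /k] /(_ qpos).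
  by rewrite pmulr_rgt0.
- have [q qpos [/key k /k]] := near_corner_ex N.
  by move=> /(_ qpos); rewrite st mul0r ltxx.
Qed.

End Germs.

(** * Tropical reflections of exponents *)

Definition monomial := (int * int)%type.

(** The exponents of the monomials that tend to infinity when y does and x
exceeds all powers of y: the lexicographically positive ones. *)
Definition large (e : monomial) : bool := (0 < e.1) || (e.1 == 0) && (0 < e.2).

(** The exponent of g(v) / u, for u and v of exponents [e] and [e'] and for g
with slopes [s]. *)
Definition tropical_reflect (s : int * int) (e e' : monomial) : monomial :=
  let a := if large e' then s.1 else s.2 in (a * e'.1 - e.1, a * e'.2 - e.2).

Fixpoint tropical_orbit (s1 s2 : int * int) n : monomial * monomial :=
  if n is n'.+1 then
    let E := tropical_orbit s1 s2 n' in
    if odd n' then (tropical_reflect s1 E.1 E.2, E.2)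
    else (E.1, tropical_reflect s2 E.2 E.1)
  else ((1, 0), (0, 1)).

Definition slopes : seq int := [:: -2; -1; 0; 1; 2].

(** Only even lengths occur, because the two determinants of exponents for
consecutive words are opposite. What matters is that a first return of the
exponents at length 12 is excluded. *)
Definition short_or_injective (s1 s2 : int * int) : bool :=
  let E := tropical_orbit s1 s2 in
  has (fun j => E j.*2 == E 0%N) [:: 2; 3; 4; 5]%N || uniq (mkseq E 13).

Definition slope_pairs := [seq (a, b) | a <- slopes, b <- slopes].

Lemma short_or_injective_all :
  all (fun s1 => all (short_or_injective s1) slope_pairs) slope_pairs.
Proof. reflexivity. Qed.

Lemma tropical_dichotomy s1 s2 :
  s1.1 \in slopes -> s1.2 \in slopes -> s2.1 \in slopes -> s2.2 \in slopes ->
  short_or_injective s1 s2.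
Proof.
have in_pairs (s : int * int) : s.1 \in slopes -> s.2 \in slopes ->
    s \in slope_pairs.
  by move=> h1 h2; apply/allpairsP; exists s; split=> //; case: s h1 h2.
move=> s11 s12 s21 s22.
have /allP := short_or_injective_all => /(_ _ (in_pairs _ s11 s12)) /allP.
exact: (fun H => H _ (in_pairs _ s21 s22)).
Qed.

(** * Orders of magnitude near the corner *)

Section Asymptotics.
Variable R : realType.
Implicit Types (q : R * R) (u v w : R * R -> R) (e : monomial).

Definition mono e q : R := q.1 ^ e.1 * q.2 ^ e.2.

Lemma mono_gt0 e q : positive q -> 0 < mono e q.
Proof. by case/andP=> q1 q2; rewrite mulr_gt0 // exprz_gt0. Qed.

Lemma mono_opp e q : mono (- e.1, - e.2) q = (mono e q)^-1.
Proof. by rewrite /mono invfM !invr_expz. Qed.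

Lemma monoZB (a : int) e e' q : positive q ->
  mono (a * e'.1 - e.1, a * e'.2 - e.2) q = mono e' q ^ a / mono e q.
Proof.
case/andP=> q1 q2; rewrite /mono !expfzDr ?gt_eqF // exprzMl ?unitfE ?expfz_neq0
  ?gt_eqF //.
by rewrite !exprz_exp -!invr_expz ![_ * a]mulrC; field; rewrite !expfz_neq0 ?gt_eqF.
Qed.

Lemma mono_large e M : large e -> near_corner (fun q => M <= mono e q).
Proof.
move=> le; have N := near_cornerI (near_corner_x_ge R `|e.2|.+1)
  (near_cornerI (near_corner_y_ge M) (near_corner_y_ge 1)).
apply: near_cornerS N => q /andP[q1 q2] [q12 [qM q2_ge1]]; apply: (le_trans qM).
case/orP: le => [e1|/andP[/eqP e1 e2]]; rewrite /mono; last first.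
  rewrite e1 expr0z mul1r; case: (e.2) e2 => // -[//|n] _.
  by rewrite -exprnP exprS ler_peMr ?exprn_ege1 // ltW.
have q1_ge1 : 1 <= q.1 by apply: le_trans q12; rewrite exprn_ege1.
apply: (@le_trans _ _ (q.2 ^+ `|e.2|.+1 * q.2 ^ e.2)).
  rewrite exprSr -mulrA mulrC mulrAC -mulrA ler_peMr ?(ltW q2) //.
  case: (e.2) => n; first by rewrite /= -exprnP -exprD exprn_ege1.
  by rewrite NegzE abszN absz_nat -exprnN mulfV // expf_neq0 ?gt_eqF.
rewrite ler_wpM2r ?exprz_ge0 ?(ltW q2) // (le_trans q12) //.
case: (e.1) e1 => // -[//|n] _.
by rewrite -exprnP exprS ler_peMr ?exprn_ege1 // ltW.
Qed.

Definition pos_fun u := forall q, positive q -> 0 < u q.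

(** A single constant bounds both ratios, which makes the relation visibly
symmetric. *)
Definition same_order u v :=
  exists2 c, 0 < c & near_corner (fun q => u q <= c * v q /\ v q <= c * u q).

Lemma same_order_refl u : pos_fun u -> same_order u u.
Proof.
move=> u0; exists 1 => //; by exists 0%N => q _ _; rewrite mul1r.
Qed.

Lemma same_order_sym u v : same_order u v -> same_order v u.
Proof. by move=> [c c0 N]; exists c => //; apply: near_cornerS N => q _ []. Qed.

Lemma same_order_trans u v w : same_order u v -> same_order v w -> same_order u w.
Proof.
move=> [c c0 N] [d d0 N']; exists (c * d); first exact: mulr_gt0.
apply: near_cornerS (near_cornerI N N') => q _ [[uv vu] [vw wv]]; split.
  by rewrite (le_trans uv) // -mulrA ler_wpM2l // ltW.
by rewrite (le_trans wv) // [c * d]mulrC -mulrA ler_wpM2l // ltW.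
Qed.

Lemma same_orderM u v u' v' : pos_fun u -> pos_fun v -> pos_fun u' -> pos_fun v' ->
  same_order u v -> same_order u' v' ->
  same_order (fun q => u q * u' q) (fun q => v q * v' q).
Proof.
move=> u0 v0 u'0 v'0 [c c0 N] [d d0 N']; exists (c * d); first exact: mulr_gt0.
apply: near_cornerS (near_cornerI N N') => q qpos [[uv vu] [uv' vu']].
by rewrite ![c * d * _]mulrACA; split; rewrite ler_pM ?(ltW (u0 _ _)) ?(ltW (v0 _ _))
  ?(ltW (u'0 _ _)) ?(ltW (v'0 _ _)).
Qed.

Lemma same_orderV u v : pos_fun u -> pos_fun v -> same_order u v ->
  same_order (fun q => (u q)^-1) (fun q => (v q)^-1).
Proof.
move=> u0 v0 [c c0 N]; exists c => //; apply: near_cornerS N => q qpos [uv vu].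
have [uq vq] := (u0 _ qpos, v0 _ qpos).
by split; rewrite ler_pdivlMr // mulrC ler_pdivrMr.
Qed.

Lemma same_orderX u v (a : int) : pos_fun u -> pos_fun v -> same_order u v ->
  same_order (fun q => u q ^ a) (fun q => v q ^ a).
Proof.
move=> u0 v0 uv.
have nat_case (n : nat) : same_order (fun q => u q ^+ n) (fun q => v q ^+ n).
  elim: n => [|n IH]; first by apply: same_order_refl => q _; rewrite expr0.
  under [fun q => u q ^+ _]eq_fun do rewrite exprS.
  under [fun q => v q ^+ _]eq_fun do rewrite exprS.
  by apply: same_orderM => // q qpos; rewrite exprn_gt0 ?u0 ?v0.
case: a => n; first exact: nat_case.
by apply: same_orderV (nat_case _) => q qpos; rewrite exprn_gt0 ?u0 ?v0.
Qed.

(** If the quotient of the two monomials were [large], it would be unbounded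
in the corner; if neither quotient is, the exponents agree. *)
Lemma same_order_mono e e' : same_order (mono e) (mono e') -> e = e'.
Proof.
suff not_large e1 e2 : same_order (mono e1) (mono e2) ->
    ~~ large (e1.1 - e2.1, e1.2 - e2.2).
  move=> ee'; have := not_large _ _ ee'; have := not_large _ _ (same_order_sym ee').
  case: e e' {ee'} => [a b] [a' b']; rewrite /large /= => h1 h2.
  by have [-> ->] : a = a' /\ b = b' by lia.
move=> [c c0 N]; apply/negP => /(mono_large (c + 1)) N'.
have [q qpos [[le1 _]]] := near_corner_ex (near_cornerI N N').
have [p1 p2] := (mono_gt0 e1 qpos, mono_gt0 e2 qpos).
have := monoZB 1 e2 e1 qpos; rewrite !mul1r expr1z => ->.
by rewrite ler_pdivlMr // leNgt (le_lt_trans le1) // ltr_pM2r // ltrDl.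
Qed.

(** The function [g] behaves like a power at infinity and like another one at
0; the slopes [s] are the two exponents. *)
Definition tame (g : R -> R) (s : int * int) :=
  (forall t, 0 < t -> 0 < g t) /\
  exists2 c, 0 < c & forall t, 0 < t ->
    let a := if 1 <= t then s.1 else s.2 in g t <= c * t ^ a /\ t ^ a <= c * g t.

(** Since e' is not (0, 0), the function v tends to infinity or to 0 in the
corner, and only the corresponding slope of g matters: this is where the
tropical reflection comes from. *)
Lemma same_order_reflect g s u v e e' : tame g s -> pos_fun u -> pos_fun v ->
  e' != (0, 0) -> same_order u (mono e) -> same_order v (mono e') ->
  same_order (fun q => g (v q) / u q) (mono (tropical_reflect s e e')).
Proof.
move=> [g0 [c c0 gc]] u0 v0 e'0 ue ve'.
pose a := if large e' then s.1 else s.2.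
have [d d0 N] := ve'.
have ga : same_order (fun q => g (v q)) (fun q => v q ^ a).
  exists c => //; rewrite /a; case: ifPn => le'.
    apply: near_cornerS (near_cornerI N (mono_large d le')) => q qpos [[_ vd] dm].
    have /gc : 0 < v q := v0 _ qpos.
    by rewrite -(ler_pM2l d0) mulr1 (le_trans dm vd).
  have lN : large (- e'.1, - e'.2).
    by case: (e') le' e'0 => x y; rewrite /large xpair_eqE /=; lia.
  apply: near_cornerS (near_cornerI N (mono_large (d + 1) lN)) => q qpos [[dv _]].
  rewrite mono_opp => dm; have /gc : 0 < v q := v0 _ qpos.
  have mp := mono_gt0 e' qpos; rewrite leNgt.
  suff -> : v q < 1 by [].
  apply: (le_lt_trans dv); rewrite -ltr_pdivlMr // mul1r (lt_le_trans _ dm) //.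
  by rewrite ltrDl.
have mpos e1 : pos_fun (mono e1) by move=> q; apply: mono_gt0.
have := same_order_trans ga (same_orderX a v0 (mpos e') ve').
move=> /same_orderM /(_ (same_orderV u0 (mpos e) ue)) [].
- by move=> q qpos; rewrite g0 ?v0.
- by move=> q qpos; rewrite exprz_gt0 ?mono_gt0.
- by move=> q qpos; rewrite invr_gt0 u0.
- by move=> q qpos; rewrite invr_gt0 mono_gt0.
move=> k k0 N''; exists k => //; apply: near_cornerS N'' => q qpos.
by rewrite /tropical_reflect -/a monoZB.
Qed.

(** One more power of y in the lower bound for x absorbs the constants by which
the coordinates may be multiplied. *)
Lemma near_corner_stable (F : R * R -> R * R) A :
  same_order (fun q => (F q).1) (fun q => q.1) ->
  same_order (fun q => (F q).2) (fun q => q.2) ->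
  near_corner A -> near_corner (fun q => A (F q)).
Proof.
move=> [c c0 N1] [d d0 N2] [n nA].
have N := near_cornerI (near_cornerI N1 N2) (near_cornerI (near_corner_x_ge R n.+2)
  (near_cornerI (near_corner_y_ge (d * n.+1%:R)) (near_corner_y_ge (c * d ^+ n.+1)))).
apply: near_cornerS N => q /andP[q1 q2] [[[_ qF1] [F2q qF2]] [q12 [y1 y2]]].
apply: nA; first by rewrite -(ler_pM2l d0) (le_trans y1).
have F2_gt0 : 0 < (F q).2 by rewrite -(pmulr_rgt0 _ d0) (lt_le_trans q2).
rewrite -(ler_pM2l c0) (le_trans _ qF1) // (le_trans _ q12) //.
apply: (@le_trans _ _ (c * (d * q.2) ^+ n.+1)).
  by rewrite ler_wpM2l ?(ltW c0) // lerXn2r // nnegrE ltW // mulr_gt0.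
by rewrite exprMn mulrA [q.2 ^+ n.+2]exprS ler_wpM2r // exprn_ge0 // ltW.
Qed.

End Asymptotics.

(** * Rational maps represented by self-maps of the positive quadrant *)

Section Substitution.
Variable R : realType.
Implicit Types (q : R * R) (P : {poly {poly R}}) (f g : ratmap R)
  (F G : R * R -> R * R).

Definition represents f F :=
  forall q, positive q -> value_at f.1 q (F q).1 /\ value_at f.2 q (F q).2.

Definition quadrant_surjection F :=
  (forall q, positive q -> positive (F q)) /\
  (forall q, positive q -> exists2 q', positive q' & F q' = q).

Lemma everywhere_near (A : R * R -> Prop) :
  (forall q, positive q -> A q) -> near_corner A.
Proof.
move=> Apos; apply: near_cornerS (near_corner_y_ge (0 : R)) => q qpos _; exact: Apos.
Qed.

(** The map [F] hits every point of the quadrant, so a polynomial vanishing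
after the substitution vanishes everywhere. This is the dominance of [f]. *)
Lemma evalXY_neq0 f F P :
  represents f F -> quadrant_surjection F -> P != 0 -> evalXY P f != 0.
Proof.
move=> fF [Fpos Fsurj]; apply: contraNneq => P0.
apply/eqP/poly2_eq0/everywhere_near => q qpos.
have [q' q'pos <-] := Fsurj q qpos; have [v1 v2] := fF q' q'pos.
have := value_at_evalXY P v1 v2; rewrite P0 => /value_at_uniq; apply.
by have := value_at_cst 0 q'; rewrite rmorph0.
Qed.

Lemma evalXYM P1 P2 f : evalXY (P1 * P2) f = evalXY P1 f * evalXY P2 f.
Proof. by rewrite /evalXY rmorphM !hornerM. Qed.

(** The substitution is defined through a fixed fraction representing [h],
whose denominator may vanish at [F q]; dominance allows to replace it by a
fraction that is regular there. *)
Lemma value_at_ratsubst h f F q r :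
  represents f F -> quadrant_surjection F -> positive q ->
  value_at h (F q) r -> value_at (ratsubst h f) q r.
Proof.
move=> fF Faut qpos hr; have [v1 v2] := fF q qpos.
have [d0 e] := ratfun_numden h.
case: hr => P [D [e' D0 ->]].
suff -> : ratsubst h f = evalXY P f / evalXY D f.
  apply: value_atM (value_at_evalXY P v1 v2) _.
  exact: value_atV (value_at_evalXY D v1 v2) D0.
apply/eqP; rewrite /ratsubst eqr_div ?(evalXY_neq0 fF) ?(horner2_neq0 D0) //.
rewrite -!evalXYM; apply/eqP; congr evalXY; apply/eqP.
by rewrite -tofrac_eq !tofracM -eqr_div ?tofrac_eq0 ?(horner2_neq0 D0) // -e -e'.
Qed.

Lemma represents_comp f F g G :
  represents f F -> quadrant_surjection F -> represents g G ->
  represents (compmap g f) (fun q => G (F q)).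
Proof.
move=> fF Faut gG q qpos; have [v1 v2] := gG _ (Faut.1 q qpos).
by split; apply: value_at_ratsubst fF Faut qpos _.
Qed.

Lemma represents_id : represents (@id_ratmap R) id.
Proof. by move=> q _; split; [apply: value_at_varx | apply: value_at_vary]. Qed.

Lemma represents_inj f g F : represents f F -> represents g F -> f = g.
Proof.
case: f g => [f1 f2] [g1 g2] fF gF; congr pair.
  by apply: (@value_at_inj _ _ _ (fun q => (F q).1)); apply: everywhere_near => q qpos;
    have [] := fF q qpos; have [] := gF q qpos.
by apply: (@value_at_inj _ _ _ (fun q => (F q).2)); apply: everywhere_near => q qpos;
  have [] := fF q qpos; have [] := gF q qpos.
Qed.

Lemma represents_uniq f F G q :
  represents f F -> represents f G -> positive q -> F q = G q.
Proof.
move=> fF fG qpos; have [v1 v2] := fF q qpos; have [w1 w2] := fG q qpos.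
by rewrite [F q]surjective_pairing [G q]surjective_pairing
  (value_at_uniq v1 w1) (value_at_uniq v2 w2).
Qed.

Lemma eq_represents f F G :
  (forall q, positive q -> F q = G q) -> represents f F -> represents f G.
Proof. by move=> FG fF q qpos; rewrite -FG //; apply: fF. Qed.

(** An inverse [h] of a represented map is not known in advance to be regular
on the quadrant, so its values cannot be used. The identity of polynomials
obtained by evaluating the composite at all points F q' suffices to recognise
it. *)
Lemma ratsubst_inverse f F k (h h' : ratfun R) (v : R * R -> R) :
  represents f F -> quadrant_surjection F -> (forall q, positive q -> k (F q) = v q) ->
  (forall q, positive q -> value_at (ratsubst h f) q (v q)) ->
  (forall q, positive q -> value_at h' q (k q)) -> h = h'.
Proof.
move=> fF Faut kF hv h'k; have [d e] := ratfun_numden h.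
apply: (@ratfun_eq_numden _ _ _ k); apply: everywhere_near => q qpos.
split; last exact: h'k.
have [q' q'pos <-] := Faut.2 q qpos; rewrite kF //.
have [w1 w2] := fF q' q'pos.
have := value_at_evalXY (\n_(repr h)) w1 w2.
have -> : evalXY (\n_(repr h)) f = ratsubst h f * evalXY (\d_(repr h)) f.
  by rewrite divfK ?(evalXY_neq0 fF).
move=> /value_at_uniq; apply; apply: value_atM (hv _ q'pos) _.
exact: value_at_evalXY.
Qed.

End Substitution.

(** * Cardinals and lists *)

Section Card.
Variables (T : choiceType) (A : set T) (n : nat).
Hypothesis An : A #= `I_n.

Let Afin : finite_set A. Proof. by apply/finite_setP; exists n. Qed.

Lemma size_uniq_le_card (s : seq T) :
  uniq s -> (forall x, x \in s -> A x) -> (size s <= n)%N.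
Proof.
move=> us sA; rewrite -(card_fset_set An); apply: uniq_leq_size => // x /sA Ax.
by rewrite in_fset_set // inE.
Qed.

Lemma card_le_size (s : seq T) :
  (forall x, A x -> x \in s) -> (n <= size s)%N.
Proof.
move=> As; rewrite -(card_fset_set An); apply: uniq_leq_size; first exact: fset_uniq.
by move=> x; rewrite in_fset_set // inE => /As.
Qed.
End Card.

(** * The group generated by two reflections of the quadrant *)

Section ReflectionGroup.
Variable R : realType.
Variables (g1 g2 : R -> R) (s1 s2 : int * int) (f1 f2 : ratmap R).
Hypotheses (g1_tame : tame g1 s1) (g2_tame : tame g2 s2).
Implicit Types (q : R * R) (b : bool).

Definition reflection b q : R * R :=
  if b then (g1 q.2 / q.1, q.2) else (q.1, g2 q.1 / q.2).

Hypotheses (f1_reflection : represents f1 (reflection true))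
           (f2_reflection : represents f2 (reflection false)).

(** The word of length [n] in the two reflections; the first letter applied is
[reflection false], and letters alternate. *)
Fixpoint alternate n q : R * R :=
  if n is n'.+1 then reflection (odd n') (alternate n' q) else q.

Fixpoint alternate_map n : ratmap R :=
  if n is n'.+1 then compmap (if odd n' then f1 else f2) (alternate_map n')
  else @id_ratmap R.

Lemma reflection_pos b q : positive q -> positive (reflection b q).
Proof.
case/andP=> q1 q2; case: g1_tame => g1p _; case: g2_tame => g2p _.
by case: b; rewrite /positive /= ?q1 ?q2 ?divr_gt0 ?g1p ?g2p.
Qed.

Lemma reflectionK b q : positive q -> reflection b (reflection b q) = q.
Proof.
case/andP=> q1 q2; case: g1_tame => g1p _; case: g2_tame => g2p _.
have [h1 h2] := (lt0r_neq0 (g1p _ q2), lt0r_neq0 (g2p _ q1)).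
case: q q1 q2 h1 h2 => x y /= x0 y0 h1 h2.
by case: b => /=; congr pair; field; rewrite ?h1 ?h2 ?gt_eqF.
Qed.

Lemma alternate_pos n q : positive q -> positive (alternate n q).
Proof. by move=> qpos; elim: n => //= n IH; apply: reflection_pos. Qed.

Lemma alternate_surjection n : quadrant_surjection (alternate n).
Proof.
split=> [q|]; first exact: alternate_pos.
elim: n => [|n IH] q qpos; first by exists q.
have [q' q'pos e] := IH _ (reflection_pos (odd n) qpos).
by exists q' => //=; rewrite e reflectionK.
Qed.

Lemma represents_reflection b : represents (if b then f1 else f2) (reflection b).
Proof. by case: b. Qed.

Lemma represents_alternate n : represents (alternate_map n) (alternate n).
Proof.
elim: n => [|n IH]; first exact: represents_id.
exact: represents_comp IH (alternate_surjection n) (represents_reflection _).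
Qed.

Lemma alternateD m n q : ~~ odd n ->
  alternate (m + n) q = alternate m (alternate n q).
Proof.
move=> n_even; elim: m => //= m ->.
by rewrite oddD (negbTE n_even) addbF.
Qed.

Let E := tropical_orbit s1 s2.

Definition exponent_det (e : monomial * monomial) : int :=
  e.1.1 * e.2.2 - e.1.2 * e.2.1.

(** Up to sign the determinant of the exponents is preserved. Hence no
coordinate of a word has exponent (0, 0), for which the corner would not decide
between the two slopes. *)
Lemma tropical_orbit_det n : exponent_det (E n) != 0.
Proof.
rewrite /E; elim: n => //= n; case: ifP => _;
  rewrite /exponent_det /tropical_reflect /=.
  set a := if _ then _ else _; case: (tropical_orbit _ _ _) => [[x1 x2] [y1 y2]] /=.
  apply: contraNneq => e; rewrite -oppr_eq0 -e; apply/eqP; ring.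
set a := if _ then _ else _; case: (tropical_orbit _ _ _) => [[x1 x2] [y1 y2]] /=.
apply: contraNneq => e; rewrite -oppr_eq0 -e; apply/eqP; ring.
Qed.

Lemma alternate_order n :
  same_order (fun q => (alternate n q).1) (mono (E n).1) /\
  same_order (fun q => (alternate n q).2) (mono (E n).2).
Proof.
rewrite /E; elim: n => [|n [IH1 IH2]].
  split.
    have -> : mono (R := R) (tropical_orbit s1 s2 0).1 = fun q => q.1.
      by apply/funext => q; rewrite /mono /= expr1z expr0z mulr1.
    by apply: same_order_refl => q /andP[].
  have -> : mono (R := R) (tropical_orbit s1 s2 0).2 = fun q => q.2.
    by apply/funext => q; rewrite /mono /= expr1z expr0z mul1r.
  by apply: same_order_refl => q /andP[].
have pos1 : pos_fun (fun q => (alternate n q).1) by move=> q /(alternate_pos n)/andP[].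
have pos2 : pos_fun (fun q => (alternate n q).2) by move=> q /(alternate_pos n)/andP[].
have := tropical_orbit_det n; rewrite /exponent_det /E => d0.
rewrite /= /reflection; case: ifP => _ /=; split=> //.
  apply: same_order_reflect g1_tame pos1 pos2 _ IH1 IH2.
  by apply: contraNneq d0 => ->; rewrite /= !mulr0 subr0.
apply: same_order_reflect g2_tame pos2 pos1 _ IH2 IH1.
by apply: contraNneq d0 => ->; rewrite /= !mul0r subr0.
Qed.

Lemma tropical_orbit_eq m n :
  (forall q, positive q -> alternate m q = alternate n q) -> E m = E n.
Proof.
move=> emn; have [[m1 m2] [n1 n2]] := (alternate_order m, alternate_order n).
have em1 : same_order (mono (R := R) (E m).1) (mono (E n).1).
  apply: same_order_trans (same_order_sym m1) _.
  case: n1 => c c0 N; exists c => //; apply: near_cornerS N => q qpos.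
  by rewrite emn.
have em2 : same_order (mono (R := R) (E m).2) (mono (E n).2).
  apply: same_order_trans (same_order_sym m2) _.
  case: n2 => c c0 N; exists c => //; apply: near_cornerS N => q qpos.
  by rewrite emn.
by rewrite [E m]surjective_pairing [E n]surjective_pairing
  (same_order_mono em1) (same_order_mono em2).
Qed.

Lemma alternate_map_eq m n : alternate_map m = alternate_map n ->
  forall q, positive q -> alternate m q = alternate n q.
Proof.
move=> e q qpos; apply: represents_uniq (represents_alternate m) _ qpos.
by rewrite e; apply: represents_alternate.
Qed.

Let G := generated_group [set f1; f2].

Lemma alternate_map_in n : G (alternate_map n).
Proof.
move=> M [[M1 MM MV] fM]; elim: n => //= n IH; apply: MM => //.
by apply: fM; case: odd; [left | right].
Qed.

Section CornerStable.
Variable n : nat.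
Hypotheses (n_even : ~~ odd n) (E_n : E n = E 0%N).

Lemma alternate_near A : near_corner A -> near_corner (fun q => A (alternate n q)).
Proof.
have [o1 o2] := alternate_order n; rewrite E_n in o1 o2.
apply: near_corner_stable.
  apply: same_order_trans o1 (same_order_sym _).
  by have [] := alternate_order 0.
apply: same_order_trans o2 (same_order_sym _).
by have [] := alternate_order 0.
Qed.

Lemma alternateM m q : alternate (m * n) q = iter m (alternate n) q.
Proof.
elim: m => // m IH.
by rewrite mulSn alternateD ?oddM ?(negbTE n_even) ?andbF //= IH.
Qed.

(** An increasing action has no nontrivial cycle: the inequality
phi < phi o S would propagate along the orbit, as S preserves the corner, and
after [m] steps give phi < phi. *)
Lemma finite_order_not_lt (phi : R * R -> R) m : (0 < m)%N ->
  (forall q, positive q -> alternate (m * n) q = q) ->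
  ~ near_corner (fun q => phi q < phi (alternate n q)).
Proof.
case: m => // m _ mid N.
have Nm k : near_corner (fun q => phi q < phi (iter k.+1 (alternate n) q)).
  elim: k => // k IH; apply: near_cornerS (near_cornerI N (alternate_near IH)).
  by move=> q _ []; rewrite -iterSr; apply: lt_trans.
have [q qpos] := near_corner_ex (Nm m).
by rewrite -alternateM mid // ltxx.
Qed.

(** Each coordinate of S has a constant sign of variation in the corner; finite
order leaves only equality, which extends from the corner to the whole quadrant
because the coordinates are rational. *)
Lemma finite_order_id m : (0 < m)%N ->
  (forall q, positive q -> alternate (m * n) q = q) ->
  forall q, positive q -> alternate n q = q.
Proof.
move=> m0 mid; have rep := represents_alternate n.
have coord (h h0 : ratfun R) (phi : R * R -> R) :
    (forall q, positive q -> value_at h q (phi (alternate n q))) ->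
    (forall q, positive q -> value_at h0 q (phi q)) -> h = h0.
  move=> hv h0v; apply/eqP; rewrite -subr_eq0; apply/eqP.
  have hh0 q : positive q -> value_at (h - h0) q (phi (alternate n q) - phi q).
    move=> qpos; apply: value_atD (hv q qpos) _; rewrite -mulN1r -[- phi q]mulN1r.
    apply: value_atM (h0v q qpos); have := value_at_cst (-1) q.
    by rewrite rmorphN1.
  have [//|[N|N]] := value_at_sign hh0; exfalso.
    apply: (@finite_order_not_lt phi m) => //.
    by apply: near_cornerS N => q _; rewrite subr_gt0.
  apply: (@finite_order_not_lt (fun q => - phi q) m) => //.
  by apply: near_cornerS N => q _; rewrite subr_lt0 ltrN2.
have e : alternate_map n = @id_ratmap R.
  rewrite [LHS]surjective_pairing; congr pair.
    apply: (coord _ _ fst) => q qpos; first by have [] := rep q qpos.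
    exact: value_at_varx.
  apply: (coord _ _ snd) => q qpos; first by have [] := rep q qpos.
  exact: value_at_vary.
by move=> q qpos; have /= := @alternate_map_eq n 0 e q qpos.
Qed.

End CornerStable.

Section FiniteOrder.
Variable n : nat.
Hypotheses (n_even : ~~ odd n) (n_gt0 : (0 < n)%N).
Hypothesis n_id : forall q, positive q -> alternate n q = q.

Lemma alternate_modn m q : positive q -> alternate m q = alternate (m %% n) q.
Proof.
move=> qpos; rewrite {1}(divn_eq m n) addnC alternateD ?oddM ?(negbTE n_even) ?andbF //.
rewrite alternateM //; congr alternate; elim: (m %/ n)%N => //= k ->.
exact: n_id.
Qed.

(** If [b] is not the next letter of the word, it is the last one and cancels.
For the empty word this requires to replace it first by the word of length [n],
which acts trivially and ends with [reflection true]. *)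
Lemma reflection_alternate b k :
  exists k', forall q, positive q -> reflection b (alternate k q) = alternate k' q.
Proof.
have [<-|bk] := eqVneq (odd k) b; first by exists k.+1.
exists (k + n).-1 => q qpos.
have -> : alternate k q = alternate (k + n) q by rewrite alternateD // n_id.
have : (0 < k + n)%N by rewrite addn_gt0 n_gt0 orbT.
have : odd (k + n) = ~~ b.
  by move: bk; rewrite oddD (negbTE n_even) addbF; case: odd; case: b.
case: (k + n)%N => //= l /negb_inj -> _.
by rewrite reflectionK //; apply: alternate_pos.
Qed.

Lemma alternate_comp l k :
  exists k', forall q, positive q -> alternate l (alternate k q) = alternate k' q.
Proof.
elim: l => [|l [k' IH]]; first by exists k.
have [k'' e] := reflection_alternate (odd l) k'.
by exists k'' => q qpos; rewrite /= IH // e.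
Qed.

Lemma alternate_inverse l :
  exists k, forall q, positive q -> alternate k (alternate l q) = q.
Proof.
elim: l => [|l [k IH]]; first by exists 0%N.
have [k0 e0] := reflection_alternate (odd l) 0.
have [k1 e1] := alternate_comp k k0.
exists k1 => q qpos /=; have lpos := alternate_pos l qpos.
rewrite -e1 ?reflection_pos // -e0 ?reflection_pos //=.
by rewrite reflectionK // IH.
Qed.

(** The maps represented by words form a group, containing [f1] and [f2] thanks
to the relation of length [n]; words are then reduced modulo [n]. *)
Lemma group_alternate_map f : G f -> exists2 m, (m < n)%N & f = alternate_map m.
Proof.
move=> Gf; suff [m fm] : exists m, represents f (alternate m).
  exists (m %% n)%N; first by rewrite ltn_mod.
  apply: represents_inj fm _.
  apply: eq_represents (represents_alternate (m %% n)) => q qpos.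
  by rewrite -alternate_modn.
apply: (Gf [set f | exists m, represents f (alternate m)]); split=> [|h /=].
  split=> /=.
  - by exists 0%N; apply: represents_id.
  - move=> h k [l hl] [m km]; have [l' e] := alternate_comp l m.
    exists l'; apply: eq_represents e _.
    exact: represents_comp km (alternate_surjection m) hl.
  - move=> h k [l hl] [_ e]; have [k' inv] := alternate_inverse l.
    exists k'.
    suff -> : k = alternate_map k' by apply: represents_alternate.
    case: k e => k1 k2 [e1 e2]; rewrite [RHS]surjective_pairing.
    have aut := alternate_surjection l.
    congr pair.
      apply: (@ratsubst_inverse _ h _ (fun q => (alternate k' q).1) _ _ fst hl aut).
      + by move=> q qpos; rewrite inv.
      + by move=> q qpos; rewrite e1; apply: value_at_varx.
      + by move=> q qpos; have [] := represents_alternate k' qpos.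
    apply: (@ratsubst_inverse _ h _ (fun q => (alternate k' q).2) _ _ snd hl aut).
    + by move=> q qpos; rewrite inv.
    + by move=> q qpos; rewrite e2; apply: value_at_vary.
    + by move=> q qpos; have [] := represents_alternate k' qpos.
have [k e] := reflection_alternate true 0.
by case=> ->; [exists k; apply: eq_represents e f1_reflection | exists 1%N].
Qed.

End FiniteOrder.

(** With 13 words of different exponents the group is too large. Otherwise a
word of length n <= 10 preserves orders of magnitude; finiteness of the group
forces it to have finite order, hence to be trivial, and the group is too
small. *)
Lemma reflection_group_card :
  s1.1 \in slopes -> s1.2 \in slopes -> s2.1 \in slopes -> s2.2 \in slopes ->
  ~ (G #= `I_12).
Proof.
move=> s11 s12 s21 s22 card12.
have /orP[/hasP[j j25 /eqP Ej]|Euniq] := tropical_dichotomy s11 s12 s21 s22; last first.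
  have in_group f : f \in mkseq alternate_map 13 -> G f.
    by case/mapP=> k _ ->; apply: alternate_map_in.
  have : uniq (mkseq alternate_map 13).
    move/mkseq_uniqP: Euniq => Einj; apply/mkseq_uniqP => k l k13 l13 e.
    by apply: Einj => //; apply: tropical_orbit_eq; apply: alternate_map_eq.
  by move=> /(size_uniq_le_card card12); rewrite size_mkseq => /(_ in_group).
pose n := j.*2; have n_even : ~~ odd n by rewrite odd_double.
have [n_gt0 n_le10] : (0 < n)%N /\ (n <= 10)%N.
  by move: j25; rewrite !inE /n => /or4P[] /eqP ->.
have [m m0 mid] : exists2 m, (0 < m)%N &
    forall q, positive q -> alternate (m * n) q = q.
  have : ~~ uniq (mkseq (fun i => alternate_map (i * n)) 13).
    have in_group f : f \in mkseq (fun i => alternate_map (i * n)) 13 -> G f.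
      by case/mapP=> k _ ->; apply: alternate_map_in.
    by apply/negP => /(size_uniq_le_card card12)/(_ in_group); rewrite size_mkseq.
  case/(uniqPn (@id_ratmap R)) => k [l []]; rewrite size_mkseq => kl l13.
  rewrite !nth_mkseq ?(ltn_trans kl) // => /alternate_map_eq e.
  exists (l - k)%N; first by rewrite subn_gt0.
  move=> q qpos; have [q' q'pos <-] := (alternate_surjection (k * n)).2 q qpos.
  by rewrite -alternateD ?oddM ?(negbTE n_even) ?andbF // -mulnDl subnK ?(ltnW kl) ?e.
have n_id := finite_order_id n_even Ej m0 mid.
have in_words f : G f -> f \in mkseq alternate_map n.
  move=> /(group_alternate_map n_even n_gt0 n_id)[k kn ->].
  by apply/mapP; exists k => //; rewrite mem_iota.
have := card_le_size card12 in_words; rewrite size_mkseq leqNgt.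
by rewrite (leq_ltn_trans n_le10).
Qed.

End ReflectionGroup.

(** * Laurent polynomials with nonnegative coefficients *)

Section Laurent.
Variable R : realType.
Implicit Types (c : int -> R) (t : R).

Definition laurent c t := \sum_(i <- steps) c i * t ^ i.

Definition nonneg c := forall i, i \in steps -> 0 <= c i.
Definition nonzero c := exists2 i, i \in steps & c i != 0.

Lemma laurentE c t : laurent c t = c (-1) * t^-1 + (c 0 + c 1 * t).
Proof.
by rewrite /laurent /steps !big_cons big_nil expr0z expr1z exprN1 mulr1 addr0.
Qed.

Lemma laurent_gt0 c t : nonneg c -> nonzero c -> 0 < t -> 0 < laurent c t.
Proof.
move=> c0 [i i_step ci] t0; rewrite /laurent (big_rem i) //.
apply: ltr_wpDr; last by rewrite mulr_gt0 ?exprz_gt0 // lt0r ci c0.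
rewrite big_seq; apply: sumr_ge0 => j /mem_rem j_step.
by rewrite mulr_ge0 ?c0 // exprz_ge0 ?ltW.
Qed.

(** Without cancellation between nonnegative coefficients, the term of highest
degree gives the order of magnitude on the whole ray t >= 1. *)
Lemma laurent_pinfty c : nonneg c -> nonzero c ->
  exists2 k, k \in steps & exists2 m, 0 < m &
    forall t, 1 <= t -> laurent c t <= m * t ^ k /\ t ^ k <= m * laurent c t.
Proof.
move=> c0 c_neq0.
have [an bn dn] : [/\ 0 <= c (-1), 0 <= c 0 & 0 <= c 1] by split; apply: c0.
have bound (k : int) x : k \in steps -> 0 < x ->
    (forall t, 1 <= t -> x * t ^ k <= laurent c t /\
                         laurent c t <= (c (-1) + c 0 + c 1) * t ^ k) ->
    exists2 k : int, k \in steps & exists2 m, 0 < m &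
    forall t, 1 <= t -> laurent c t <= m * t ^ k /\ t ^ k <= m * laurent c t.
  move=> k_step x0 xk; exists k => //; exists (c (-1) + c 0 + c 1 + x^-1).
    by rewrite ltr_wpDl ?addr_ge0 // invr_gt0.
  move=> t t1; have t0 := lt_le_trans ltr01 t1.
  have [lo hi] := xk t t1; have tk : 0 < t ^ k by rewrite exprz_gt0.
  have L0 := laurent_gt0 c0 c_neq0 t0.
  split; first by rewrite (le_trans hi) // ler_wpM2r ?(ltW tk) // lerDl invr_ge0 ltW.
  rewrite mulrDl (@le_trans _ _ (x^-1 * laurent c t)) //.
    by rewrite mulrC ler_pdivlMr // mulrC.
  by rewrite lerDr mulr_ge0 ?addr_ge0 // ltW.
have tV t : 1 <= t -> t^-1 <= 1 by move=> t1; rewrite invf_le1 // (lt_le_trans ltr01).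
have tVp t : 1 <= t -> 0 < t^-1 by move=> t1; rewrite invr_gt0 (lt_le_trans ltr01).
have [d0|d0] := eqVneq (c 1) 0; last first.
  apply: (bound 1 (c 1)) => //; first by rewrite lt0r d0.
  move=> t t1; have [h1 h2] := (tV t t1, tVp t t1).
  by rewrite laurentE expr1z; split; nra.
have [b0|b0] := eqVneq (c 0) 0; last first.
  apply: (bound 0 (c 0)) => //; first by rewrite lt0r b0.
  move=> t t1; have [h1 h2] := (tV t t1, tVp t t1).
  by rewrite laurentE expr0z d0; split; nra.
have a0 : c (-1) != 0.
  case: c_neq0 => i; rewrite !inE => /or3P[] /eqP -> //; by rewrite ?b0 ?d0 eqxx.
apply: (bound (-1) (c (-1))) => //; first by rewrite lt0r a0.
by move=> t t1; rewrite laurentE exprN1 b0 d0; split; lra.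
Qed.

Lemma laurent_inv c t : laurent c t^-1 = laurent (fun i => c (- i)) t.
Proof. by rewrite !laurentE opprK oppr0 invrK; ring. Qed.

(** The behaviour at 0 is the one at infinity after t -> 1/t, which reverses the
coefficients. *)
Lemma laurent_tame c : nonneg c -> nonzero c ->
  exists s, [/\ s.1 \in steps, s.2 \in steps & tame (laurent c) s].
Proof.
move=> c0 c_neq0; have stepN (i : int) : i \in steps -> - i \in steps.
  by rewrite !inE => /or3P[] /eqP ->.
have [k k_step [m m0 km]] := laurent_pinfty c0 c_neq0.
have cN0 : nonneg (fun i => c (- i)) by move=> i /stepN/c0.
have cN_neq0 : nonzero (fun i => c (- i)).
  by case: c_neq0 => i i_step ci; exists (- i); rewrite ?stepN // opprK.
have [l l_step [m' m'0 lm']] := laurent_pinfty cN0 cN_neq0.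
exists (k, - l); split=> //; first exact: stepN.
split=> [t t0|]; first exact: laurent_gt0.
exists (m + m') => [|t t0 /=]; first exact: addr_gt0.
have L0 := laurent_gt0 c0 c_neq0 t0.
case: ifPn => [t1|]; [|rewrite -ltNge => /ltW t1].
  have [h1 h2] := km t t1; split.
    by rewrite (le_trans h1) // ler_wpM2r ?exprz_ge0 ?(ltW t0) // lerDl ltW.
  by rewrite (le_trans h2) // ler_wpM2r ?(ltW L0) // lerDl ltW.
have /lm' : 1 <= t^-1 by rewrite invf_ge1.
rewrite -laurent_inv invrK exprz_inv => -[h1 h2]; split.
  by rewrite (le_trans h1) // ler_wpM2r ?exprz_ge0 ?(ltW t0) // lerDr ltW.
by rewrite (le_trans h2) // ler_wpM2r ?(ltW L0) // lerDr ltW.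
Qed.

Lemma tame_div (g h : R -> R) s r : tame g s -> tame h r ->
  tame (fun t => g t / h t) (s.1 - r.1, s.2 - r.2).
Proof.
move=> [g0 [c c0 gc]] [h0 [d d0 hd]]; split=> [t t0|].
  by rewrite divr_gt0 ?g0 ?h0.
exists (c * d) => [|t t0 /=]; first exact: mulr_gt0.
have -> : (if 1 <= t then s.1 - r.1 else s.2 - r.2) =
  (if 1 <= t then s.1 else s.2) - (if 1 <= t then r.1 else r.2) by case: ifP.
have [gp hp] := (g0 t t0, h0 t t0).
have [] := gc t t0; have [] := hd t t0.
set a := if _ then s.1 else _; set b := if _ then r.1 else _ => h1 h2 h3 h4.
rewrite expfzDr ?gt_eqF // -invr_expz.
have [ta tb] : 0 < t ^ a /\ 0 < t ^ b by rewrite !exprz_gt0.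
split; rewrite mulrACA ler_pM ?invr_ge0 ?(ltW gp) ?(ltW hp) ?(ltW ta) ?(ltW tb) //;
  by rewrite ler_pdivlMr // mulrC ler_pdivrMr.
Qed.

Lemma laurent_ratio_tame c d : nonneg c -> nonzero c -> nonneg d -> nonzero d ->
  exists s, [/\ s.1 \in slopes, s.2 \in slopes &
                tame (fun t => laurent c t / laurent d t) s].
Proof.
move=> c0 cn d0 dn; have [s [s1 s2 st]] := laurent_tame c0 cn.
have [r [r1 r2 rt]] := laurent_tame d0 dn.
exists (s.1 - r.1, s.2 - r.2); split=> /=; last exact: tame_div.
  by move: s1 r1; rewrite !inE => /or3P[] /eqP -> /or3P[] /eqP ->.
by move: s2 r2; rewrite !inE => /or3P[] /eqP -> /or3P[] /eqP ->.
Qed.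

Lemma value_at_involution (c x a : ratfun R) q rc rx ra :
  value_at c q rc -> value_at x q rx -> value_at a q ra ->
  rx != 0 -> ra != 0 -> value_at (c / (x * a)) q (rc / ra / rx).
Proof.
move=> hc hx ha rx0 ra0; rewrite -mulrA -invfM [ra * rx]mulrC.
apply: value_atM hc _; apply: value_atV; last by rewrite mulf_neq0.
exact: value_atM.
Qed.

Lemma value_atXz (h : ratfun R) q r (i : int) : value_at h q r -> r != 0 ->
  value_at (h ^ i) q (r ^ i).
Proof.
move=> hr r0.
have nat_case (n : nat) : value_at (h ^+ n) q (r ^+ n).
  elim: n => [|n IH]; last by rewrite !exprS; apply: value_atM.
  by have := value_at_cst 1 q; rewrite rmorph1.
case: i => n; first exact: nat_case.
by rewrite NegzE -!exprnN; apply: value_atV (nat_case _) _; rewrite expf_neq0.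
Qed.

Lemma value_at_laurent (h : ratfun R) q r c : value_at h q r -> r != 0 ->
  value_at (\sum_(i <- steps) cst (c i) * h ^ i) q (laurent c r).
Proof.
move=> hr r0; rewrite /laurent; elim: steps => [|i s IH].
  by rewrite !big_nil; have := value_at_cst 0 q; rewrite rmorph0.
rewrite !big_cons; apply: value_atD IH; apply: value_atM; first exact: value_at_cst.
exact: value_atXz.
Qed.

Lemma sum_cst_nonzero (h : ratfun R) c :
  \sum_(i <- steps) cst (c i) * h ^ i != 0 -> nonzero c.
Proof.
move=> s0; apply: contrapT => nz; move/negP: s0; apply.
rewrite big_seq big1 // => i i_step.
have [->|ci] := eqVneq (c i) 0; first by rewrite rmorph0 mul0r.
by case: nz; exists i.
Qed.

End Laurent.

(** * Walks *)

Theorem theorem7p1 (R : realType) (p : int -> int -> R)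
    (p_ge0 : forall i j : int, i \in steps -> j \in steps -> 0 <= p i j)
    (p_sum1 : \sum_(i <- steps) \sum_(j <- steps) p i j = 1)
    (A1_neq0 : A1 p != 0) (C1_neq0 : C1 p != 0)
    (A2_neq0 : A2 p != 0) (C2_neq0 : C2 p != 0) :
  ~ (walk_group p #= `I_12).
Proof.
have row_ge0 i : i \in steps -> nonneg (p i) by move=> hi j; apply: p_ge0.
have col_ge0 j : j \in steps -> nonneg (p^~ j) by move=> hj i hi; apply: p_ge0.
have a1 := sum_cst_nonzero A1_neq0; have c1 := sum_cst_nonzero C1_neq0.
have a2 := sum_cst_nonzero A2_neq0; have c2 := sum_cst_nonzero C2_neq0.
have [s1 [s11 s12 t1]] :=
  laurent_ratio_tame (row_ge0 (-1) isT) c1 (row_ge0 1 isT) a1.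
have [s2 [s21 s22 t2]] :=
  laurent_ratio_tame (col_ge0 (-1) isT) c2 (col_ge0 1 isT) a2.
apply: (reflection_group_card t1 t2 _ _ s11 s12 s21 s22) => q /andP[q1 q2] /=.
  split; last exact: value_at_vary.
  have val i := value_at_laurent (p i) (value_at_vary q) (lt0r_neq0 q2).
  apply: value_at_involution (val (-1)) (value_at_varx q) (val 1) _ _.
    exact: lt0r_neq0.
  exact: lt0r_neq0 (laurent_gt0 (row_ge0 1 isT) a1 q2).
split; first exact: value_at_varx.
have val j := value_at_laurent (p^~ j) (value_at_varx q) (lt0r_neq0 q1).
apply: value_at_involution (val (-1)) (value_at_vary q) (val 1) _ _.
  exact: lt0r_neq0.
exact: lt0r_neq0 (laurent_gt0 (col_ge0 1 isT) a2 q1).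
Qed.
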